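(* Both the configuration of cornered $A_3^8(1)$-polytopes in $4_{21}$ with a fixed center and the configuration of $A_3^7(1)$-polytopes in $3_{21}$ equal the $4$-Steiner system $\mathcal{S}_C(4,S_7)$ on $S_7$.
   Context: For $r=7,8$, $S_r$ is a del Pezzo surface (smooth, $-K_{S_r}$ ample) obtained by blowing up $\mathbb{P}^2$ at $r$ points, with canonical class $K_{S_r}$. A line is a class $l\in\mathrm{Pic}\,S_r$ with $l^2=l\cdot K_{S_r}=-1$; $L_r$ is the set of lines, which is the vertex set of the Gosset polytope $(r-4)_{21}$ (the convex hull of $L_r$ in $\mathrm{Pic}\,S_r\otimes\mathbb{Q}$). An $A_3^r(1)$-polytope in $(r-4)_{21}$ is given by four distinct lines in $L_r$ with pairwise intersection number $1$; its center is the sum of these lines. The vertex figure of $l\in L_r$ is $\{l'\in L_r: l'\cdot l=0\}$. An $A_3^8(1)$-polytope is cornered if there is a line $l\in L_8$ whose vertex figure contains all its lines. The configuration of a class of such polytopes is the family of sets of lines forming them; a configuration on $S_8$ is compared with a family of sets of lines on $S_7$ by blowing down a line. A $k$-Steiner system on $S_r$ is a family of sets of $k$ lines in $\mathrm{Pic}\,S_r$ where each $k-1$ lines with constant intersection to each other determine exactly one set of the family. $\mathcal{S}_C(4,S_7)$ is the family of all sets $\{l_1,l_2,l_3,l_4\}\subset L_7$ with $l_i\cdot l_j=1$ for $i\neq j$; here any three lines of $L_7$ with pairwise intersection $1$ determine exactly one such set. *)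

(* Defs.v *)
From mathcomp Require Export all_boot all_order all_algebra finmap.
From mathcomp Require Export all_classical.

Set Implicit Arguments.
Unset Strict Implicit.
Unset Printing Implicit Defensive.

Import GRing.Theory Num.Theory.
Local Open Scope classical_set_scope.
Local Open Scope ring_scope.

(* The Picard lattice of a blow-up S_r of the projective plane at r points, in
   the basis h (pullback of the class of a line), e_1, ..., e_r (the
   exceptional classes): coordinate 0 is that of h, coordinate lift ord0 i
   that of e_(i+1).  One has h.h = 1, e_i.e_i = -1, and distinct basis elements
   are orthogonal. *)
Notation Pic r := 'rV[int]_(r.+1).

Definition inter r (x y : Pic r) : int :=
  x 0 ord0 * y 0 ord0 - \sum_(i < r) x 0 (lift ord0 i) * y 0 (lift ord0 i).

(* K = -3 h + e_1 + ... + e_r. *)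
Definition canon r : Pic r := \row_j (if j == ord0 then - 3 else 1).

Definition lines r : set (Pic r) :=
  [set l | inter l l = -1 /\ inter l (canon r) = -1].
Arguments lines : clear implicits.

Definition vertex_figure r (l : Pic r) : set (Pic r) :=
  [set l' | lines r l' /\ inter l' l = 0].

Definition PicQ_of r (x : Pic r) : 'rV[rat]_(r.+1) := map_mx intr x.

(* The convex hull, in Pic S_r tensored with the rationals, of a set of
   classes. *)
Definition hull r (X : set (Pic r)) : set 'rV[rat]_(r.+1) :=
  [set p | exists A : {fset Pic r}, exists w : Pic r -> rat,
     [/\ [set` A] `<=` X,
         forall x, 0 <= w x,
         \sum_(x <- A) w x = 1
       & p = \sum_(x <- A) w x *: PicQ_of x]].

(* The polytope (r-4)_21. *)
Definition gosset r : set 'rV[rat]_(r.+1) := hull (lines r).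
Arguments gosset : clear implicits.

Definition is_line_set r (k : nat) (A : {fset Pic r}) : Prop :=
  [set` A] `<=` lines r /\ #|` A| = k.

Definition const_inter r (c : int) (A : {fset Pic r}) : Prop :=
  forall x y, x \in A -> y \in A -> x != y -> inter x y = c.

(* The value c of the constant intersection number is part of the data. *)
Definition steiner_system r (k : nat) (c : int) (F : set {fset Pic r}) : Prop :=
  F `<=` [set A | is_line_set k A] /\
  forall T : {fset Pic r}, is_line_set k.-1 T -> const_inter c T ->
    exists! A : {fset Pic r}, F A /\ (T `<=` A)%fset.

Definition S_C4 r : set {fset Pic r} :=
  [set A | is_line_set 4 A /\ const_inter 1 A].
Arguments S_C4 : clear implicits.

(* The A_3^r(1)-polytopes in (r-4)_21. *)
Definition A3_polytope r (P : set 'rV[rat]_(r.+1)) : Prop :=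
  P `<=` gosset r /\
  exists A : {fset Pic r},
    [/\ is_line_set 4 A, const_inter 1 A & P = hull [set` A]].

(* All lines are extreme points of (r-4)_21 (r = 7, 8), so the lines lying in a
   polytope spanned by lines are the lines spanning it. *)
Definition lines_of r (P : set 'rV[rat]_(r.+1)) : set (Pic r) :=
  [set l | lines r l /\ P (PicQ_of l)].

Definition center r (P : set 'rV[rat]_(r.+1)) : Pic r :=
  \sum_(l \in lines_of P) l.

Definition cornered_by r (l : Pic r) (P : set 'rV[rat]_(r.+1)) : Prop :=
  lines r l /\ lines_of P `<=` vertex_figure l.

Definition cornered r (P : set 'rV[rat]_(r.+1)) : Prop :=
  exists l : Pic r, cornered_by l P.

(* The configuration of a class of polytopes: the sets of lines which form
   (i.e. span) a polytope of the class. *)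
Definition configuration r (C : set (set 'rV[rat]_(r.+1))) :
    set {fset Pic r} :=
  [set A | [set` A] `<=` lines r /\ C (hull [set` A])].

(* f is the push-forward on Picard groups along the contraction of l, up to the
   choice of the basis of Pic S_r.  The last clause comes from
   x = f^* (f x) - (x.l) l and l.l = -1, where f^* is the pull-back: an isometry
   onto the orthogonal complement of l. *)
Definition blow_down r (l : Pic r.+1) (f : {additive Pic r.+1 -> Pic r}) : Prop :=
  [/\ f l = 0,
      forall y, exists x, f x = y,
      f (canon r.+1) = canon r
    & forall x y, inter (f x) (f y) = inter x y + inter x l * inter y l].

(* Main.v *)
Require Import Defs.
From HB Require Import structures.
From mathcomp Require Import zify lra.
Set Implicit Arguments.
Unset Strict Implicit.
Unset Printing Implicit Defensive.
Import Order.TTheory GRing.Theory Num.Theory.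
Local Open Scope classical_set_scope.
Local Open Scope ring_scope.

(** The form on K^perp, for K the canonical class, is negative definite as long
    as there are at most eight blown-up points, and almost everything follows
    from that.

    Two distinct lines x and y satisfy x.y >= 0, since x - y lies in K^perp and
    has square -2 - 2 x.y.  So the functional p |-> l.p is negative at a line l
    and nonnegative at all other lines: a line in the convex hull of a set of
    lines belongs to that set ([lines_of_hull]).  A polytope spanned by lines
    thus determines them, and configurations become families of sets of lines.

    Let s be the sum of four lines with pairwise intersection 1; then s.s = 8
    and s.K = -4.  On S_7 the class s + 2K is orthogonal to K and of square 0,
    so s = -2K ([S_C4_center_7]): three of the lines determine the fourth as
    -2K minus their sum, and conversely this class is always a line meeting each
    of the three once.  This is the Steiner property.  On S_8, if the four lines
    are orthogonal to a line l, the same argument gives s = 2l - 2K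
    ([S_C4_center_8]).  The center thus determines l, and the cornered polytopes
    of that center are exactly those in the vertex figure of l
    ([cornered_configuration]).  Blowing down l maps the orthogonal complement
    of l isometrically onto Pic S_7, compatibly with K, and so matches the two
    families ([blow_down_S_C4]).

    That every line l can be blown down ([blow_down_exists]) is the classical
    reduction by quadratic transformations: either l is exceptional, and one
    drops a coordinate, or Noether's inequality provides three exceptional
    classes such that the reflection in h - e_i - e_j - e_k lowers the degree
    l.h. *)

(** * The intersection form *)

Lemma interC r (x y : Pic r) : inter x y = inter y x.
Proof.
rewrite /inter mulrC; congr (_ - _).
by apply: eq_bigr => i _; rewrite mulrC.
Qed.

Lemma interDl r (x y z : Pic r) : inter (x + y) z = inter x z + inter y z.
Proof.
rewrite /inter !mxE mulrDl.
under eq_bigr do rewrite !mxE mulrDl.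
by rewrite big_split /= opprD addrACA.
Qed.

Lemma interZl r (a : int) (x y : Pic r) : inter (a *: x) y = a * inter x y.
Proof.
rewrite /inter !mxE mulrBr mulr_sumr mulrA.
by under eq_bigr do rewrite !mxE -mulrA.
Qed.

Lemma interDr r (x y z : Pic r) : inter z (x + y) = inter z x + inter z y.
Proof. by rewrite interC interDl !(interC z). Qed.

Lemma interZr r (a : int) (x y : Pic r) : inter y (a *: x) = a * inter y x.
Proof. by rewrite interC interZl (interC y). Qed.

Lemma interNl r (x y : Pic r) : inter (- x) y = - inter x y.
Proof. by rewrite -scaleN1r interZl mulN1r. Qed.

Lemma interNr r (x y : Pic r) : inter y (- x) = - inter y x.
Proof. by rewrite interC interNl (interC y). Qed.

Lemma inter0l r (y : Pic r) : inter 0 y = 0.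
Proof. by rewrite -(scale0r 0) interZl mul0r. Qed.

Lemma inter_suml r (s : seq (Pic r)) (y : Pic r) :
  inter (\sum_(x <- s) x) y = \sum_(x <- s) inter x y.
Proof.
elim: s => [|x s IHs]; first by rewrite !big_nil inter0l.
by rewrite !big_cons interDl IHs.
Qed.

Definition inter_bilinear r :=
  (@interDl r, @interDr r, @interNl r, @interNr r, @interZl r, @interZr r).

Definition hyperplane r : Pic r := delta_mx 0 ord0.
Arguments hyperplane : clear implicits.
Definition exceptional r (i : 'I_r) : Pic r := delta_mx 0 (lift ord0 i).

Lemma inter_hyperplane r (x : Pic r) : inter x (hyperplane r) = x 0 ord0.
Proof.
rewrite /inter mxE !eqxx mulr1 big1 ?subr0 // => i _.
by rewrite mxE mulr0.
Qed.

Lemma inter_exceptional r (x : Pic r) (i : 'I_r) :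
  inter x (exceptional i) = - x 0 (lift ord0 i).
Proof.
rewrite /inter mxE /= mulr0 sub0r (bigD1 i) //= mxE !eqxx mulr1 big1 ?addr0 //.
by move=> j ji; rewrite mxE (inj_eq lift_inj) (negPf ji) andbF mulr0.
Qed.

Lemma inter_nondegenerate r (x : Pic r) : (forall y, inter x y = 0) -> x = 0.
Proof.
move=> x0; apply/rowP => j; rewrite [RHS]mxE.
case: (unliftP ord0 j) => [i ->|->].
  by apply/eqP; rewrite -oppr_eq0 -inter_exceptional x0.
by rewrite -inter_hyperplane.
Qed.

Lemma inter_canon r (x : Pic r) :
  inter x (canon r) = - 3 * x 0 ord0 - \sum_(i < r) x 0 (lift ord0 i).
Proof.
rewrite /inter mxE eqxx mulrC; congr (_ - _).
by apply: eq_bigr => i _; rewrite mxE mulr1.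
Qed.

Lemma canon_sqr r : inter (canon r) (canon r) = 9 - r%:R.
Proof.
rewrite inter_canon mxE eqxx; under eq_bigr do rewrite mxE /=.
by rewrite sumr_const card_ord.
Qed.

(** For x in K^perp, with h-coordinate a and e_i-coordinates x_i,
    9 x.x = - sum_i (3 x_i + a)^2 - (9 - r) a^2. *)
Lemma canon_perp_definite r (x : Pic r) : (r < 9)%N ->
  inter x (canon r) = 0 -> 0 <= inter x x -> x = 0.
Proof.
move=> r9; rewrite inter_canon => /eqP; rewrite subr_eq0 => /eqP xK xx.
have r9' : 0 < 9 - r%:R :> int by rewrite subr_gt0 -[9]/(9%:R) ltr_nat.
set a := x 0 ord0 in xK *; pose u i := 3 * x 0 (lift ord0 i) + a.
have sqr : 9 * inter x x = - (\sum_(i < r) u i ^+ 2) - (9 - r%:R) * a ^+ 2.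
  have -> : \sum_(i < r) u i ^+ 2 =
      9 * \sum_(i < r) x 0 (lift ord0 i) * x 0 (lift ord0 i)
      + 6 * a * \sum_(i < r) x 0 (lift ord0 i) + r%:R * a ^+ 2.
    have -> : r%:R * a ^+ 2 = \sum_(i < r) a ^+ 2.
      by rewrite sumr_const card_ord mulr_natl.
    rewrite !mulr_sumr -!big_split /=.
    by apply: eq_bigr => i _; rewrite /u; lra.
  by rewrite -xK /inter -/a; lra.
have u0 : 0 <= \sum_(i < r) u i ^+ 2 by apply: sumr_ge0 => i _; apply: sqr_ge0.
have a0 : a = 0.
  apply/eqP; rewrite -sqrf_eq0 eq_le sqr_ge0 andbT -(pmulr_rle0 _ r9').
  lra.
have /eqP : \sum_(i < r) u i ^+ 2 = 0.
  apply/eqP; rewrite eq_le u0 andbT; move: sqr; rewrite a0 expr0n mulr0; lra.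
rewrite psumr_eq0; last by move=> i _; apply: sqr_ge0.
move=> /allP ui; apply/rowP => j; rewrite [RHS]mxE.
case: (unliftP ord0 j) => [i ->|-> //].
have := ui i (mem_index_enum i); rewrite /= sqrf_eq0 /u a0 addr0 mulf_eq0 /=.
by move/eqP.
Qed.

(** Integrality gives x.y <= -1, whence x - y, which lies in K^perp, has
    nonnegative square. *)
Lemma lines_eq r (x y : Pic r) : (r < 9)%N -> lines r x -> lines r y ->
  inter x y < 0 -> x = y.
Proof.
move=> r9 [xx xK] [yy yK] xy.
have xy1 : inter x y <= -1 by rewrite -ltzD1.
apply/eqP; rewrite -subr_eq0; apply/eqP/canon_perp_definite => //.
  by rewrite !inter_bilinear xK yK subrr.
rewrite !inter_bilinear xx yy (interC y x); lra.
Qed.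

Lemma lines_inter_ge0 r (x y : Pic r) : (r < 9)%N -> lines r x -> lines r y ->
  x != y -> 0 <= inter x y.
Proof.
by move=> r9 lx ly; apply: contraNT; rewrite -ltNge => /lines_eq ->.
Qed.

(** * Lines in a convex hull *)

(** The functional l.- extended to rational points. *)
Definition interQ r (l : Pic r) (p : 'rV[rat]_r.+1) : rat :=
  (l 0 ord0)%:~R * p 0 ord0
  - \sum_(i < r) (l 0 (lift ord0 i))%:~R * p 0 (lift ord0 i).

Lemma interQ_PicQ r (l x : Pic r) : interQ l (PicQ_of x) = (inter l x)%:~R.
Proof.
rewrite /interQ /inter rmorphB rmorphM rmorph_sum mxE /=; congr (_ - _).
by apply: eq_bigr => i _; rewrite mxE rmorphM.
Qed.

Lemma interQ_sum r (l : Pic r) (s : seq (Pic r)) (w : Pic r -> rat) :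
  interQ l (\sum_(x <- s) w x *: PicQ_of x) =
  \sum_(x <- s) w x * (inter l x)%:~R.
Proof.
elim: s => [|x s IHs].
  by rewrite !big_nil /interQ !mxE mulr0 big1 ?subr0 // => i _; rewrite mxE mulr0.
rewrite !big_cons -IHs -interQ_PicQ /interQ !mxE mulrBr mulr_sumr.
rewrite addrACA -opprD -big_split /=; congr (_ - _); first by lra.
by apply: eq_bigr => i _; rewrite !mxE; lra.
Qed.

Lemma hull_vertex r (X : set (Pic r)) (x : Pic r) : X x -> hull X (PicQ_of x).
Proof.
move=> Xx; exists [fset x]%fset, (fun=> 1); split => //.
- by move=> y /=; rewrite inE => /eqP ->.
- by rewrite big_seq_fset1.
- by rewrite big_seq_fset1 scale1r.
Qed.

Lemma subset_hull r (X Y : set (Pic r)) : X `<=` Y -> hull X `<=` hull Y.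
Proof.
move=> XY p [A [w [AX w0 w1 ->]]]; exists A, w; split => //.
exact: subset_trans AX XY.
Qed.

(** The functional l.- separates a line l from the hull of any other lines. *)
Lemma lines_of_hull r (A : set (Pic r)) : (r < 9)%N -> A `<=` lines r ->
  lines_of (hull A) = A.
Proof.
move=> r9 Al; apply/seteqP; split => [l [ll]|l Ai]; last first.
  by split; [exact: Al | exact: hull_vertex].
move=> [B [w [BA w0 _ lE]]]; apply: contrapT => lA.
have : 0 <= interQ l (PicQ_of l).
  rewrite lE interQ_sum big_seq; apply: sumr_ge0 => x xB; apply: mulr_ge0 => //.
  have Ax : A x by apply: BA.
  rewrite ler0z; apply: lines_inter_ge0 => //; first exact: Al.
  by apply/eqP => lx; apply: lA; rewrite lx.
by rewrite interQ_PicQ (proj1 ll).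
Qed.

Lemma hull_inj r (A B : {fset Pic r}) : (r < 9)%N ->
  [set` A] `<=` lines r -> [set` B] `<=` lines r ->
  hull [set` A] = hull [set` B] -> A = B.
Proof.
move=> r9 Al Bl AB; apply/fsetP => x.
have /seteqP[sAB sBA] : [set` A] = [set` B].
  by rewrite -(lines_of_hull r9 Al) AB lines_of_hull.
by apply/idP/idP; [apply: sAB | apply: sBA].
Qed.

Lemma A3_polytope_hull r (A : {fset Pic r}) : (r < 9)%N ->
  [set` A] `<=` lines r -> A3_polytope (hull [set` A]) <-> S_C4 r A.
Proof.
move=> r9 Al; split=> [[_ [B [lB B1 /hull_inj ->]]] //|[lA A1]].
  by case: lB.
by split; [exact: subset_hull | exists A].
Qed.

Lemma center_hull r (A : {fset Pic r}) : (r < 9)%N ->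
  [set` A] `<=` lines r -> center (hull [set` A]) = \sum_(x <- A) x.
Proof.
by move=> r9 Al; rewrite /center lines_of_hull // -fsbig_seq // fset_uniq.
Qed.

(** * Sums of lines with constant intersection *)

Lemma inter_sum_mem r (A : {fset Pic r}) (c : int) (x : Pic r) :
  [set` A] `<=` lines r -> const_inter c A -> x \in A ->
  inter (\sum_(y <- A) y) x = c * (#|` A|%:R - 1) - 1.
Proof.
move=> Al Ac xA; rewrite (big_fsetD1 x) //= interDl (proj1 (Al x xA)) inter_suml.
rewrite (eq_big_seq (fun=> c)) => [|y]; last first.
  by rewrite !inE => /andP[yx yA]; rewrite Ac.
rewrite big_const_seq count_predT iter_addr addr0.
by rewrite (cardfsD1 x A) xA natrD (addrC true%:R) addrK mulr_natr addrC.
Qed.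

Lemma inter_sum_canon r (A : {fset Pic r}) : [set` A] `<=` lines r ->
  inter (\sum_(y <- A) y) (canon r) = - #|` A|%:R.
Proof.
move=> Al; rewrite inter_suml (eq_big_seq (fun=> -1)) => [|y /Al[]//].
by rewrite big_const_seq count_predT iter_addr addr0 mulNrn.
Qed.

Lemma inter_sum_sqr r (A : {fset Pic r}) (c : int) :
  [set` A] `<=` lines r -> const_inter c A ->
  inter (\sum_(y <- A) y) (\sum_(y <- A) y) =
  #|` A|%:R * (c * (#|` A|%:R - 1) - 1).
Proof.
move=> Al Ac; rewrite {1}inter_suml.
rewrite (eq_big_seq (fun=> c * (#|` A|%:R - 1) - 1)) => [|y yA].
  by rewrite big_const_seq count_predT iter_addr addr0 mulr_natl.
by rewrite interC (inter_sum_mem Al Ac).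
Qed.

(** The sum minus its expected value is orthogonal to K and has square 0. *)
Lemma S_C4_center_7 (A : {fset Pic 7}) : S_C4 7 A ->
  \sum_(x <- A) x = (-2) *: canon 7.
Proof.
move=> [[Al A4] A1]; apply/eqP; rewrite -subr_eq0; apply/eqP.
have sK := inter_sum_canon Al; have ss := inter_sum_sqr Al A1.
apply: canon_perp_definite => //; rewrite !inter_bilinear ?(interC (canon 7) (\sum_(x <- A) x)).
  by rewrite sK A4 canon_sqr.
by rewrite ss sK A4 canon_sqr.
Qed.

(** As for [S_C4_center_7]; on the blow-down of l the sum is -2K, and the pullback
    of K is K - l. *)
Lemma S_C4_center_8 (A : {fset Pic 8}) (l : Pic 8) : S_C4 8 A ->
  lines 8 l -> (forall x, x \in A -> inter x l = 0) ->
  \sum_(x <- A) x = 2 *: l - 2 *: canon 8.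
Proof.
move=> [[Al A4] A1] [ll lK] lA; apply/eqP; rewrite -subr_eq0; apply/eqP.
have sK := inter_sum_canon Al; have ss := inter_sum_sqr Al A1.
have sl : inter (\sum_(x <- A) x) l = 0.
  by rewrite inter_suml big_seq big1.
apply: canon_perp_definite => //; rewrite !inter_bilinear
  ?(interC _ (\sum_(x <- A) x)) ?(interC (canon 8) l).
  by rewrite sK lK A4 canon_sqr.
by rewrite sl ll lK ss sK A4 canon_sqr.
Qed.

(** The only candidate for the fourth line is z = -2K - s, s being the sum of the
    given three, and z.z = -1, z.K = -1 and z.x = 1 for each of these three x. *)
Lemma S_C4_steiner_7 : steiner_system 4 1 (S_C4 7).
Proof.
split=> [A [] //|T [Tl T3] T1].
have sK := inter_sum_canon Tl; have ss := inter_sum_sqr Tl T1.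
have st x : x \in T -> inter (\sum_(y <- T) y) x = 1.
  by move=> xT; rewrite (inter_sum_mem Tl T1 xT) T3.
rewrite T3 in sK ss.
set s := \sum_(y <- T) y in sK ss st; pose z := (-2) *: canon 7 - s.
have lz : lines 7 z.
  split; rewrite /z !inter_bilinear ?(interC (canon 7) s) canon_sqr sK //.
  by rewrite ss.
have zt x : x \in T -> inter z x = 1.
  move=> xT; rewrite /z !inter_bilinear st // (interC (canon 7)).
  by rewrite (proj2 (Tl x xT)).
have zT : z \notin T by apply/negP => /zt; rewrite (proj1 lz).
exists (z |` T)%fset; split.
  split; last exact: fsubsetU1.
  split; first split.
  - by move=> x /=; rewrite !inE => /orP[/eqP -> //|]; apply: Tl.
  - by rewrite cardfsU1 zT /= T3.
  - move=> x y; rewrite !inE => /orP[/eqP ->|xT] /orP[/eqP ->|yT].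
    + by rewrite eqxx.
    + by rewrite zt.
    + by rewrite interC zt.
    + exact: T1.
move=> A [SA TA]; have AE := S_C4_center_7 SA.
have /cardfs1P[z' z'E] : #|` A `\` T|%fset == 1%N.
  by case: SA => -[_ A4] _; rewrite cardfsDS // A4 T3.
have z'T : z' \notin T.
  by have := fset11 z'; rewrite -z'E inE => /andP[].
have AE' : A = (z' |` T)%fset by rewrite -z'E fsetUC -{1}(fsetIidPr TA) fsetID.
rewrite AE'; congr (_ |` _)%fset.
by rewrite /z -AE AE' big_fsetU1 //= addrK.
Qed.

(** * Existence of blow-downs *)

(** This is the reflection in the hyperplane orthogonal to a when a.a = -2. *)
Definition reflection r (a x : Pic r) : Pic r := x + inter x a *: a.

Lemma reflection_is_zmod_morphism r (a : Pic r) :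
  zmod_morphism (reflection a).
Proof.
move=> x y; rewrite /reflection !inter_bilinear scalerBl.
by rewrite opprD addrACA.
Qed.

HB.instance Definition _ r (a : Pic r) :=
  GRing.isZmodMorphism.Build (Pic r) (Pic r) (reflection a)
    (reflection_is_zmod_morphism a).

Section Reflection.
Variables (r : nat) (a : Pic r).
Hypotheses (aa : inter a a = -2) (aK : inter a (canon r) = 0).

Lemma reflectionK : involutive (reflection a).
Proof.
move=> x; rewrite /reflection !inter_bilinear aa.
by rewrite -addrA -!scalerDl [X in X *: _](_ : _ = 0) ?scale0r ?addr0 //; lra.
Qed.

Lemma reflection_isometry x y :
  inter (reflection a x) (reflection a y) = inter x y.
Proof. rewrite /reflection !inter_bilinear aa (interC a y); lra. Qed.

Lemma reflection_canon : reflection a (canon r) = canon r.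
Proof. by rewrite /reflection interC aK scale0r addr0. Qed.

Lemma reflection_lines l : lines r l -> lines r (reflection a l).
Proof.
move=> [ll lK]; split; first by rewrite reflection_isometry.
by rewrite -{1}reflection_canon reflection_isometry.
Qed.

End Reflection.

Lemma blow_down_reflection r (a l : Pic r.+1) (f : {additive Pic r.+1 -> Pic r}) :
  inter a a = -2 -> inter a (canon r.+1) = 0 ->
  blow_down (reflection a l) f -> blow_down l (f \o reflection a).
Proof.
move=> aa aK [fl fsurj fK ff]; split => //=.
- by move=> y; have [x <-] := fsurj y; exists (reflection a x); rewrite reflectionK.
- by rewrite reflection_canon.
- by move=> x y; rewrite ff !reflection_isometry.
Qed.

Lemma lift_lift0 n (i : 'I_n.+1) (j : 'I_n) :
  lift (lift ord0 i) (lift ord0 j) = lift ord0 (lift i j).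
Proof. by apply: val_inj; rewrite /= bumpS. Qed.

Lemma lift_lift_ord0 n (i : 'I_n.+1) : lift (lift ord0 i) ord0 = ord0.
Proof. exact: val_inj. Qed.

Lemma blow_down_exceptional r (i : 'I_r.+1) :
  blow_down (exceptional i) (col' (lift ord0 i) : {additive Pic r.+1 -> Pic r}).
Proof.
split.
- by apply/rowP => j; rewrite !mxE eq_sym (negPf (neq_lift _ _)).
- move=> y; exists (\row_j oapp (y 0) 0 (unlift (lift ord0 i) j)).
  by apply/rowP => j; rewrite !mxE liftK.
- apply/rowP => j; rewrite !mxE; case: (unliftP ord0 j) => [k|] ->.
    by rewrite lift_lift0.
  by rewrite lift_lift_ord0.
- move=> x y; rewrite !inter_exceptional /inter !mxE lift_lift_ord0.
  under eq_bigr do rewrite !mxE lift_lift0.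
  rewrite (bigD1_ord i) //=; lra.
Qed.

(** Noether's inequality for a class of degree a and multiplicities m.  If i, j, k
    are chosen with the three largest multiplicities and m i + m j + m k <= a,
    then bounding m x by m k in one factor of m x * m x for the other x gives
    sum_x m x * m x < a * a + 1. *)
Lemma noether_inequality r (a : int) (m : 'I_r.+3 -> int) :
  (forall i, 0 <= m i) -> \sum_i m i = 3 * a - 1 ->
  \sum_i m i * m i = a * a + 1 ->
  exists i j k, [/\ j != i, k != i, k != j & a < m i + m j + m k].
Proof.
move=> m0 sum_m sum_mm.
case: (@arg_maxP _ _ 'I_r.+3 ord0 predT m isT) => i _ maxi.
have ji : lift i ord0 != i by rewrite eq_sym neq_lift.
case: (@arg_maxP _ _ _ _ (fun j => j != i) m ji) => j {}ji maxj.
have [k0 k0P] : exists k, (k != i) && (k != j).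
  have [j' jE] : exists j' : 'I_r.+2, j = lift i j'.
    by case: (unliftP i j) ji => [j' ->|->]; [exists j' | rewrite eqxx].
  exists (lift i (lift j' (ord0 : 'I_r.+1))); rewrite jE (inj_eq lift_inj).
  by rewrite eq_sym neq_lift eq_sym neq_lift.
case: (@arg_maxP _ _ _ _ (fun k => (k != i) && (k != j)) m k0P) => k /andP[ki kj] maxk.
exists i, j, k; split=> //; rewrite ltNge; apply/negP => le_a.
have mij : m j <= m i by apply: maxi.
have mjk : m k <= m j by apply: maxj.
have rest : \sum_(x | (x != i) && (x != j)) m x * m x <=
    m k * (3 * a - 1 - m i - m j).
  have -> : 3 * a - 1 - m i - m j = \sum_(x | (x != i) && (x != j)) m x.
    by rewrite -sum_m (bigD1 i) //= (bigD1 j) //= !(addrC _ (- _)) !addKr.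
  by rewrite mulr_sumr; apply: ler_sum => x /maxk; apply: ler_wpM2r.
move: sum_mm; rewrite (bigD1 i) //= (bigD1 j) //= => sum_mm.
have bound : a * a + 1 <= m i * m i + m j * m j + m k * (3 * a - 1 - m i - m j).
  by rewrite -sum_mm addrA lerD2l.
(* In terms of the nonnegative m k, m j - m k, m i - m j and
   a - (m i + m j + m k), the difference of the two sides of the bound is a
   polynomial with nonnegative coefficients and constant term 1. *)
have mk0 := m0 k; move: (m i) (m j) (m k) mij mjk mk0 le_a bound => x y z.
rewrite -subr_ge0 -[(z <= y)%R]subr_ge0 -[(_ <= a)%R]subr_ge0 => p q z0 t.
clear -p q z0 t.
nia.
Qed.

Lemma lines_exceptional r (i : 'I_r) : lines r (exceptional i).
Proof.
split; first by rewrite inter_exceptional mxE !eqxx.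
by rewrite interC inter_exceptional mxE.
Qed.

(** A line other than the e_i meets all of them nonnegatively; its degree a is
    then positive because 3 a - 1 is the sum of its multiplicities. *)
Lemma line_exceptional_or_reducible r (l : Pic r.+3) : (r.+3 < 9)%N ->
  lines r.+3 l ->
  (exists i : 'I_r.+3, l = exceptional i) \/
  0 < inter l (hyperplane r.+3) /\
  exists i j k : 'I_r.+3, [/\ j != i, k != i, k != j &
    inter l (hyperplane r.+3) < inter l (exceptional i) + inter l (exceptional j)
      + inter l (exceptional k)].
Proof.
move=> r9 ll.
have [/existsP[i li]|/existsPn m0] :=
    boolP [exists i : 'I_r.+3, inter l (exceptional i) < 0].
  by left; exists i; apply: lines_eq => //; apply: lines_exceptional.
right; have {}m0 i : 0 <= inter l (exceptional i) by rewrite leNgt m0.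
have sum_m : \sum_i inter l (exceptional i) = 3 * inter l (hyperplane r.+3) - 1.
  under eq_bigr do rewrite inter_exceptional.
  have := proj2 ll; rewrite inter_canon inter_hyperplane sumrN; lra.
split.
  have : 0 <= \sum_i inter l (exceptional i) by apply: sumr_ge0.
  by rewrite sum_m; lia.
apply: noether_inequality => //.
under eq_bigr do rewrite inter_exceptional mulrNN.
have := proj1 ll; rewrite {1}/inter inter_hyperplane; lra.
Qed.

(** Induction on the degree: the reflection in h - e_i - e_j - e_k turns a
    degree a into 2 a - (m i + m j + m k). *)
Lemma blow_down_exists r (l : Pic r.+3) : (r.+3 < 9)%N -> lines r.+3 l ->
  exists f : {additive Pic r.+3 -> Pic r.+2}, blow_down l f.
Proof.
move=> r9 ll; have [n] : exists n : nat, inter l (hyperplane r.+3) <= n%:Z.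
  by exists `|inter l (hyperplane r.+3)|%N; rewrite abszE ler_norm.
elim: n l ll => [|n IHn] l ll ln;
    have [[i ->]|[l0 [i [j [k [ji ki kj lijk]]]]]] := line_exceptional_or_reducible r9 ll.
- by exists (col' (lift ord0 i) : {additive _ -> _}); apply: blow_down_exceptional.
- by lia.
- by exists (col' (lift ord0 i) : {additive _ -> _}); apply: blow_down_exceptional.
pose a := hyperplane r.+3 - exceptional i - exceptional j - exceptional k.
have eh (x : 'I_r.+3) : inter (exceptional x) (hyperplane r.+3) = 0.
  by rewrite inter_hyperplane mxE.
have ee (x y : 'I_r.+3) : inter (exceptional x) (exceptional y) = - (x == y)%:R.
  by rewrite inter_exceptional mxE (inj_eq lift_inj) eq_sym.
have hh : inter (hyperplane r.+3) (hyperplane r.+3) = 1.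
  by rewrite inter_hyperplane mxE.
have aa : inter a a = -2.
  rewrite /a !inter_bilinear ?(interC (hyperplane _) (exceptional _)) !eh !ee hh.
  by rewrite !eqxx ![i == _]eq_sym [j == k]eq_sym (negPf ji) (negPf ki) (negPf kj).
have aK : inter a (canon r.+3) = 0.
  rewrite /a !inter_bilinear !(proj2 (lines_exceptional _)).
  by rewrite interC inter_hyperplane mxE.
have [|f fP] := IHn (reflection a l) (reflection_lines aa aK ll).
  rewrite /reflection /a !inter_bilinear !eh hh; lia.
by exists (f \o reflection a : {additive _ -> _}); apply: blow_down_reflection.
Qed.

(** * Lines along a blow-down *)

Section BlowDown.
Variables (r : nat) (l : Pic r.+1) (f : {additive Pic r.+1 -> Pic r}).
Hypotheses (ll : lines r.+1 l) (fP : blow_down l f).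

Lemma blow_down_inter x y : inter x l = 0 -> inter (f x) (f y) = inter x y.
Proof. by case: fP => _ _ _ -> ->; rewrite mul0r addr0. Qed.

(** f is isometric on the orthogonal complement of l and the form on Pic r.+1 is
    nondegenerate. *)
Lemma blow_down_inj x y : inter x l = 0 -> inter y l = 0 -> f x = f y -> x = y.
Proof.
move=> xl yl fxy; apply/eqP; rewrite -subr_eq0; apply/eqP.
apply: inter_nondegenerate => z; rewrite -blow_down_inter.
  by rewrite raddfB fxy subrr inter0l.
by rewrite !inter_bilinear xl yl subrr.
Qed.

(** Any preimage x may be replaced by its projection x + (x.l) l. *)
Lemma blow_down_surj y : exists2 x, inter x l = 0 & f x = y.
Proof.
case: fP => fl fsurj _ _; have [x <-] := fsurj y.
exists (x + inter x l *: l).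
  by rewrite !inter_bilinear (proj1 ll); lra.
by rewrite raddfD /= -[inter x l]intz scaler_int raddfMz fl mul0rz addr0.
Qed.

Lemma blow_down_lines x : inter x l = 0 -> lines r (f x) <-> lines r.+1 x.
Proof.
move=> xl; have [_ _ fK _] := fP.
by rewrite /lines /= -(blow_down_inter x xl) -(blow_down_inter (canon _) xl) fK.
Qed.

Lemma blow_down_S_C4 (A : {fset Pic r.+1}) :
  (forall x, x \in A -> inter x l = 0) ->
  S_C4 r [fset f x | x in A]%fset <-> S_C4 r.+1 A.
Proof.
move=> Al.
have finj : {in A &, injective f}.
  by move=> x y xA yA; apply: blow_down_inj; apply: Al.
rewrite /S_C4 /= /is_line_set card_in_imfset //=.
split=> [[[fAl A4] fA1]|[[Al' A4] A1]]; do 2?split => //.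
- by move=> x xA; apply/blow_down_lines; [exact: Al | apply: fAl; apply: in_imfset].
- move=> x y xA yA xy; rewrite -blow_down_inter; last exact: Al.
  apply: fA1; rewrite ?in_imfset //.
  by apply: contra xy => /eqP /finj ->.
- move=> y /imfsetP[x /= xA ->].
  by apply/blow_down_lines; [exact: Al | exact: Al'].
- move=> _ _ /imfsetP[x /= xA ->] /imfsetP[y /= yA ->] fxy.
  rewrite blow_down_inter; last exact: Al.
  by apply: A1 => //; apply: contra fxy => /eqP ->.
Qed.

End BlowDown.

(** A polytope of center D cornered by a line l' has D = 2 l' - 2 K, so that
    l' = l. *)
Lemma cornered_configuration (D l : Pic 8) : D = 2 *: l - 2 *: canon 8 ->
  lines 8 l ->
  configuration [set P : set 'rV[rat]_9 | [/\ A3_polytope P, cornered P & center P = D]] =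
  [set A | S_C4 8 A /\ forall x, x \in A -> inter x l = 0].
Proof.
move=> DE ll; apply/seteqP; split => A /= => [[Al []]|[SA Al]].
  move=> /A3_polytope_hull SA [l' [ll']]; rewrite lines_of_hull // center_hull //.
  move=> Al' AD; have {}SA := SA isT Al.
  have {}Al' x : x \in A -> inter x l' = 0 by move=> /Al'[].
  split => //; suff <- : l' = l by [].
  move: AD; rewrite DE (S_C4_center_8 SA ll') // => /addIr/rowP ll2.
  by apply/rowP => j; have := ll2 j; rewrite !mxE => /mulfI; apply.
have lA : [set` A] `<=` lines 8 by case: SA => -[].
split => //; split.
- exact/A3_polytope_hull.
- exists l; split => //; rewrite lines_of_hull // => x xA; split; [exact: lA | exact: Al].
- by rewrite center_hull // DE; apply: S_C4_center_8.
Qed.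

Theorem theorem10 :
  [/\ steiner_system 4 1 (S_C4 7),
      configuration (@A3_polytope 7) = S_C4 7
    & forall (D l : Pic 8),
        (exists P, [/\ A3_polytope P, cornered_by l P & center P = D]) ->
        let config := configuration
          [set P : set 'rV[rat]_9 | [/\ A3_polytope P, cornered P & center P = D]] in
        (exists f : {additive Pic 8 -> Pic 7}, blow_down l f) /\
        forall f : {additive Pic 8 -> Pic 7}, blow_down l f ->
          let blow_down_set (A : {fset Pic 8}) := [fset f x | x in A]%fset in
          set_inj config blow_down_set /\
          [set blow_down_set A | A in config] = S_C4 7].
Proof.
split.
- exact: S_C4_steiner_7.
- apply/seteqP; split => A; first by move=> [Al /A3_polytope_hull]; apply.
  move=> SA; have Al : [set` A] `<=` lines 7 by case: SA => -[].
  by split => //; apply/A3_polytope_hull.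
move=> D l [P [PA3 [ll Pl] PD]] config.
have DE : D = 2 *: l - 2 *: canon 8.
  case: PA3 Pl PD => _ [A [lA A1 ->]]; have [Al _] := lA.
  rewrite lines_of_hull // center_hull // => Al' <-.
  by apply: S_C4_center_8 => // x /Al'[].
have configE := cornered_configuration DE ll; rewrite -/config in configE.
split=> [|f fP blow_down_set]; first exact: blow_down_exists.
split.
  rewrite configE => A B /set_mem[_ Al] /set_mem[_ Bl] fAB.
  apply/fsetP => x.
  apply/idP/idP => [xA|xB].
    have : f x \in blow_down_set A by apply: in_imfset.
    rewrite fAB => /imfsetP[y /= yB /(blow_down_inj fP) ->] //; [exact: Al|exact: Bl].
  have : f x \in blow_down_set B by apply: in_imfset.
  rewrite -fAB => /imfsetP[y /= yA /(blow_down_inj fP) ->] //; [exact: Bl|exact: Al].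
rewrite configE; apply/seteqP; split => [_ [A [SA Al] <-]|B SB].
  exact/(blow_down_S_C4 fP Al).
have [g gl fg] : exists2 g : Pic 7 -> Pic 8, forall y, inter (g y) l = 0 & cancel g f.
  have /choice[g gP] : forall y, exists x, inter x l = 0 /\ f x = y.
    by move=> y; have [x xl fx] := blow_down_surj ll fP y; exists x.
  by exists g => y; have [] := gP y.
pose A := [fset g y | y in B]%fset.
have fA : blow_down_set A = B.
  apply/fsetP => y; apply/imfsetP/idP => /= [[_ /imfsetP[z /= zB ->] ->]|yB].
    by rewrite fg.
  by exists (g y); rewrite ?in_imfset ?fg.
have Al x : x \in A -> inter x l = 0 by move=> /imfsetP[y _ ->].
by exists A => //; split => //; apply/(blow_down_S_C4 fP Al); rewrite [X in S_C4 7 X]fA.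
Qed.
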